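(* Let $n\ge 27$, let $\mathcal{X},\mathcal{Y}$ be finite alphabets with $|\mathcal{X}|\ge 2$, $|\mathcal{Y}|\ge 2$, let $\mathbf{X}$ be a discrete random vector on $\mathcal{X}^n$ and let $\mathbf{Y}$ be a random vector on $\mathcal{Y}^n$ with $\Pr(\mathbf{Y}=\mathbf{y}\mid \mathbf{X}=\mathbf{x})=p_{Y|X}^n(\mathbf{y}|\mathbf{x})=\prod_{i=1}^n p_{Y|X}(y_i|x_i)$ for some conditional distribution $p_{Y|X}$. Let $\alpha\in\left(\frac{\log_2 n}{n},\frac{1}{8\ln 2}\right)$. Then there exist a set $\mathcal{A}^\dagger\subseteq\mathcal{X}^n$ with $$p_{\mathbf{X}}(\mathcal{A}^\dagger)\ge \frac1n\log_2\frac n8,$$ and positive real numbers $\delta=O(-\sqrt{\alpha}\log_2\alpha)$ and $r<2n\log_2|\mathcal{Y}|$ such that $$\Pr\left(|h(\mathbf{Y}|U)-r|>n\delta+h(U)\,\middle|\,U=u\right)<3\cdot 2^{-n\alpha}$$ for every discrete random variable $U$ such that $U,\mathbf{X},\mathbf{Y}$ form a Markov chain in that order, and every $u$ in the support of $U$ with $\Pr(\mathbf{X}\in\mathcal{A}^\dagger\mid U=u)=1$.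
   Context: For discrete random variables $A,B$, $h(A|B)$ denotes the random variable $-\log_2 p_{A|B}(A|B)$ and $h(B)=-\log_2 p_B(B)$; in particular, conditioned on $U=u$, $h(U)=-\log_2 p_U(u)$. The notation $f=O(g)$ means there is a constant $c>0$, possibly depending on the alphabet cardinalities $|\mathcal{X}|,|\mathcal{Y}|$ but not otherwise, such that $|f|\le c|g|$. *)

(* Defs.v *)
From mathcomp Require Import all_boot all_order all_algebra.
From mathcomp Require Import all_classical all_reals all_analysis.
Set Implicit Arguments. Unset Strict Implicit. Unset Printing Implicit Defensive.
Import Order.TTheory GRing.Theory Num.Theory.
Local Open Scope ring_scope.
Local Open Scope classical_set_scope.
Import numFieldNormedType.Exports.

Section Defs.
Variable R : realType.

Definition log2 (x : R) : R := ln x / ln 2.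

Definition is_dist (T : finType) (p : T -> R) : Prop :=
  (forall t, 0 <= p t) /\ \sum_(t : T) p t = 1.

Definition is_channel (X Y : finType) (W : X -> Y -> R) : Prop :=
  forall x, is_dist (W x).

Definition chan_n (X Y : finType) (n : nat) (W : X -> Y -> R)
  (x : {ffun 'I_n -> X}) (y : {ffun 'I_n -> Y}) : R :=
  \prod_(i < n) W (x i) (y i).

(* Joint pmf pUXY u x y = Pr(U=u, X=x, Y=y) of a discrete random variable U
   (values relabelled in nat) together with (X,Y), where (X,Y) has joint pmf
   pX(x) p^n_{Y|X}(y|x), and U, X, Y form a Markov chain U - X - Y:
   P(u,x,y) P(x) = P(u,x) P(x,y). *)
Definition markov_UXY (X Y : finType) (n : nat) (pX : {ffun 'I_n -> X} -> R)
  (W : X -> Y -> R) (pUXY : nat -> {ffun 'I_n -> X} -> {ffun 'I_n -> Y} -> R)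
  : Prop :=
  (forall u x y, 0 <= pUXY u x y) /\
  (forall x y, (fun N : nat => \sum_(0 <= u < N) pUXY u x y) @ \oo -->
                 pX x * chan_n W x y) /\
  (forall u x y, pUXY u x y * pX x =
                 (\sum_(y' : {ffun 'I_n -> Y}) pUXY u x y') * (pX x * chan_n W x y)).

Definition pU (X Y : finType) (n : nat)
  (pUXY : nat -> {ffun 'I_n -> X} -> {ffun 'I_n -> Y} -> R) (u : nat) : R :=
  \sum_(x : {ffun 'I_n -> X}) \sum_(y : {ffun 'I_n -> Y}) pUXY u x y.

Definition condP (X Y : finType) (n : nat)
  (pUXY : nat -> {ffun 'I_n -> X} -> {ffun 'I_n -> Y} -> R) (u : nat)
  (E : {ffun 'I_n -> X} -> {ffun 'I_n -> Y} -> bool) : R :=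
  (\sum_(x : {ffun 'I_n -> X}) \sum_(y : {ffun 'I_n -> Y} | E x y) pUXY u x y)
  / pU pUXY u.

Definition hU (X Y : finType) (n : nat)
  (pUXY : nat -> {ffun 'I_n -> X} -> {ffun 'I_n -> Y} -> R) (u : nat) : R :=
  - log2 (pU pUXY u).

Definition hY_U (X Y : finType) (n : nat)
  (pUXY : nat -> {ffun 'I_n -> X} -> {ffun 'I_n -> Y} -> R) (u : nat)
  (y : {ffun 'I_n -> Y}) : R :=
  - log2 ((\sum_(x : {ffun 'I_n -> X}) pUXY u x y) / pU pUXY u).

End Defs.

(* Main.v *)
(** Cut the range [0, 2 n log2 |Y|] of -log2 p_Y into K ~ n / (2 log2 (n/8))
    bins of width w, and let e = 2^(-n alpha).  Put x in the j-th slice when j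
    is such that W^n(. | x) gives the outputs with -log2 p_Y(y) < j w mass less
    than e, but those with -log2 p_Y(y) < (j+1) w mass at least e.  The slices
    carry at least half of p_X, so some slice A has mass at least 1/(2K).
    If U = u forces X into A, then:
    - p(u) p(y|u) <= p_Y(y), hence h(y|u) < j w - h(u) has probability < e;
    - the set of outputs with -log2 p_Y(y) < (j+1) w has at most 2^((j+1)w)
      elements and conditional probability at least e, so (blowing-up) its
      Hamming neighbourhood of radius 4 n sqrt(alpha) has probability at least
      1 - e, while its cardinality grows only by a factor
      2^(O(n sqrt(alpha) |log2 alpha|)); small values of p(y|u) on this
      neighbourhood therefore have total mass less than e.
    The blowing-up estimate comes from E[F] E[1/F] <= cosh(t)^n under a product
    measure, for F = exp(t * distance to the set); this form of the bound
    tensorizes. *)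
Require Import Defs.
From mathcomp Require Import all_boot all_order all_algebra.
From mathcomp Require Import all_classical all_reals all_analysis.
From mathcomp Require Import ring lra zify.
Set Implicit Arguments.
Unset Strict Implicit.
Unset Printing Implicit Defensive.
Import Order.TTheory GRing.Theory Num.Theory numFieldNormedType.Exports.
Local Open Scope ring_scope.

(** * Products of means under a product measure *)

(** On [1/s, s] the function x + 1/x is largest at the endpoints: the gap factors as (s - x)(xs -
    1)/(xs). *)
Lemma add_inv_le (R : realFieldType) (s x : R) :
  0 < x -> x <= s -> x^-1 <= s -> x + x^-1 <= s + s^-1.
Proof.
move=> x0 xs xVs; have s0 : 0 < s := lt_le_trans x0 xs.
have h : 1 <= x * s by rewrite -ler_pdivrMl // mulr1.
have -> : s + s^-1 = x + x^-1 + (s - x) * (x * s - 1) / (x * s).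
  by field; rewrite !gt_eqF.
rewrite lerDl divr_ge0 ?mulr_ge0 ?subr_ge0 //.
all: exact: ltW.
Qed.

(** The product is a double sum of the ratios z = F a / F b. Exchanging [a] and [b] turns z into
    1/z, so twice the product averages z + 1/z with z in [1/s, s]. *)
Lemma mean_mul_mean_inv_le (R : realType) (T : finType) (p F : T -> R) (s : R) :
  is_dist p -> (forall a, 0 < F a) -> (forall a b, F a <= s * F b) ->
  (\sum_a p a * F a) * (\sum_a p a / F a) <= (s + s^-1) / 2.
Proof.
move=> [p0 p1] F0 Fs.
have e1 : (\sum_a p a * F a) * (\sum_a p a / F a) =
          \sum_a \sum_b p a * p b * (F a / F b).
  by rewrite big_distrlr; apply: eq_bigr => a _; apply: eq_bigr => b _ /=; ring.
have e2 : (\sum_a p a * F a) * (\sum_a p a / F a) =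
          \sum_a \sum_b p a * p b * (F a / F b)^-1.
  rewrite e1 exchange_big; apply: eq_bigr => a _; apply: eq_bigr => b _.
  by rewrite invf_div; ring.
rewrite ler_pdivlMr // mulr_natr mulr2n {1}e1 e2 -big_split /=.
have -> : s + s^-1 = \sum_a \sum_b p a * p b * (s + s^-1).
  under eq_bigr do rewrite -mulr_suml -mulr_sumr p1 mulr1.
  by rewrite -mulr_suml p1 mul1r.
apply: ler_sum => a _; rewrite -big_split /=; apply: ler_sum => b _.
rewrite -mulrDr ler_wpM2l ?mulr_ge0 // add_inv_le ?divr_gt0 //.
  by rewrite ler_pdivrMr.
by rewrite invf_div ler_pdivrMr.
Qed.

Definition ffun_cons (T : finType) (n : nat) (a : T) (g : {ffun 'I_n -> T}) :
  {ffun 'I_n.+1 -> T} := [ffun i => oapp g a (unlift ord0 i)].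

Lemma ffun_cons0 (T : finType) (n : nat) (a : T) (g : {ffun 'I_n -> T}) :
  ffun_cons a g ord0 = a.
Proof. by rewrite ffunE unlift_none. Qed.

Lemma ffun_consS (T : finType) (n : nat) (a : T) (g : {ffun 'I_n -> T}) i :
  ffun_cons a g (lift ord0 i) = g i.
Proof. by rewrite ffunE liftK. Qed.

Lemma big_ffun_cons (R : nmodType) (T : finType) (n : nat)
    (F : {ffun 'I_n.+1 -> T} -> R) :
  \sum_f F f = \sum_g \sum_a F (ffun_cons a g).
Proof.
rewrite pair_bigA /=.
rewrite (reindex (fun q : {ffun 'I_n -> T} * T => ffun_cons q.2 q.1)) //=.
exists (fun f : {ffun 'I_n.+1 -> T} => ([ffun i => f (lift ord0 i)], f ord0)).
  case=> g a _ /=; rewrite ffun_cons0; congr pair.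
  by apply/ffunP => i; rewrite ffunE ffun_consS.
move=> f _ /=; apply/ffunP => i.
by case: (unliftP ord0 i) => [j|] ->; rewrite ?ffun_consS ?ffun_cons0 ?ffunE.
Qed.

Lemma sum_prod_ffun (R : realType) (I T : finType) (F : I -> T -> R) :
  \sum_(f : {ffun I -> T}) \prod_i F i (f i) = \prod_i \sum_a F i a.
Proof. by rewrite bigA_distr_bigA. Qed.

(* Averaging F over one coordinate preserves the Lipschitz condition, and
   conditionally on the others the mean of 1/F is at most cosh t times the
   inverse of the mean of F; this drives the induction. *)
Lemma mean_mul_mean_inv_prod_le (R : realType) (T : finType) (n : nat)
    (p : 'I_n -> T -> R) (F : {ffun 'I_n -> T} -> R) (s : R) :
  (forall i, is_dist (p i)) -> 1 <= s -> (forall f, 0 < F f) ->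
  (forall i (f g : {ffun 'I_n -> T}), (forall j, j != i -> f j = g j) -> F f <= s * F g) ->
  (\sum_(f : {ffun 'I_n -> T}) (\prod_i p i (f i)) * F f) *
  (\sum_(f : {ffun 'I_n -> T}) (\prod_i p i (f i)) / F f)
    <= ((s + s^-1) / 2) ^+ n.
Proof.
move=> + s1; have s0 : 0 < s by apply: lt_le_trans s1.
elim: n p F => [|n IHn] p F pd F0 FL.
  rewrite expr0.
  have E (G : {ffun 'I_0 -> T} -> R) f0 :
      \sum_(f : {ffun 'I_0 -> T}) (\prod_i p i (f i)) * G f = G f0.
    rewrite (bigD1 f0) //= big_ord0 mul1r big1 ?addr0 // => f.
    by case/negP; apply/eqP/ffunP; case.
  have [f0 _|/= nof] := pickP (fun _ : {ffun 'I_0 -> T} => true).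
    by rewrite (E F f0) (E (fun f => (F f)^-1) f0) divff ?gt_eqF.
  by rewrite big1 ?mul0r // => f; have := nof f.
pose q i := p (lift ord0 i).
pose G g := \sum_a p ord0 a * F (ffun_cons a g).
have E (H : {ffun 'I_n.+1 -> T} -> R) :
    \sum_(f : {ffun 'I_n.+1 -> T}) (\prod_i p i (f i)) * H f =
    \sum_(g : {ffun 'I_n -> T}) (\prod_i q i (g i)) * \sum_a p ord0 a * H (ffun_cons a g).
  rewrite big_ffun_cons; apply: eq_bigr => g _; rewrite mulr_sumr.
  apply: eq_bigr => a _; rewrite big_ord_recl ffun_cons0.
  rewrite (eq_bigr (fun i => q i (g i))) => [|i _]; last by rewrite ffun_consS.
  by rewrite mulrCA mulrA.
have G0 g : 0 < G g.
  have [p0 p1] := pd ord0.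
  rewrite lt_neqAle sumr_ge0 ?andbT => [|a _]; last by rewrite mulr_ge0 // ltW.
  apply/negP => /eqP/esym /psumr_eq0P => h.
  have /eqP := oner_neq0 R; case; rewrite -p1 big1 // => a _.
  have /eqP := h (fun a _ => mulr_ge0 (p0 a) (ltW (F0 _))) a isT.
  by rewrite mulf_eq0 (gt_eqF (F0 _)) orbF => /eqP.
have GL i (f g : {ffun 'I_n -> T}) : (forall j, j != i -> f j = g j) -> G f <= s * G g.
  move=> fg; rewrite /G mulr_sumr; apply: ler_sum => a _.
  rewrite mulrCA ler_wpM2l //; first by have [] := pd ord0.
  apply: (FL (lift ord0 i)) => j ji.
  case: (unliftP ord0 j) ji => [k|] ->; rewrite ?ffun_cons0 ?ffun_consS // => ki.
  by apply: fg; apply: contra_neq ki => ->.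
have := IHn q G (fun i => pd _) G0 GL.
rewrite !E exprSr => IH.
pose c := (s + s^-1) / 2.
have c0 : 0 <= c by rewrite divr_ge0 // addr_ge0 ?invr_ge0 // ltW.
have P0 g : 0 <= \prod_i q i (g i).
  by apply: prodr_ge0 => i _; have [q0 _] := pd (lift ord0 i); exact: q0.
(* One-coordinate inequality with the tail [g] frozen: the mean of 1/F over the head is at most
   [c / G g]. *)
have step : \sum_(g : {ffun 'I_n -> T}) (\prod_i q i (g i)) * (\sum_a p ord0 a / F (ffun_cons a g))
    <= (\sum_(g : {ffun 'I_n -> T}) (\prod_i q i (g i)) / G g) * c.
  rewrite mulr_suml; apply: ler_sum => g _; rewrite -mulrA ler_wpM2l //.
  rewrite ler_pdivlMl //; apply: mean_mul_mean_inv_le => // a b.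
  apply: (FL ord0) => j j0.
  by case: (unliftP ord0 j) j0 => [k|] ->; rewrite ?eqxx ?ffun_consS.
apply: le_trans (ler_wpM2l _ step) _.
  by apply: sumr_ge0 => g _; rewrite mulr_ge0 // ltW // G0.
rewrite -/c mulrA; apply: ler_wpM2r => //.
Qed.

(** * Hamming neighbourhoods *)

(** Hamming distance to the nearest point of [B], written through the largest number of agreements
    because an empty maximum is 0; an empty [B] is thus at distance [n]. *)
Definition setdist (T : finType) (n : nat) (B : {set {ffun 'I_n -> T}})
    (f : {ffun 'I_n -> T}) : nat :=
  (n - \max_(b in B) #|[pred i | f i == b i]|)%N.

Lemma setdist_lip (T : finType) (n : nat) (B : {set {ffun 'I_n -> T}})
    (i : 'I_n) (f g : {ffun 'I_n -> T}) :
  (forall j, j != i -> f j = g j) -> (setdist B f <= (setdist B g).+1)%N.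
Proof.
move=> fg; rewrite /setdist.
suff : (\max_(b in B) #|[pred i | g i == b i]| <=
        (\max_(b in B) #|[pred i | f i == b i]|).+1)%N by lia.
apply/bigmax_leqP => b bB.
apply: leq_trans (_ : (#|[pred i | f i == b i]|.+1 <= _)%N); last first.
  by rewrite ltnS (leq_bigmax_cond b).
apply: (@leq_trans #|[predU1 i & [pred i | f i == b i]]|); last first.
  by rewrite cardU1 -addn1 addnC leq_add2l leq_b1.
apply/subset_leq_card/fintype.subsetP => j; rewrite !inE => /eqP gb.
by have [//|ji] := eqVneq j i; rewrite fg // gb eqxx.
Qed.

Lemma setdist_mem (T : finType) (n : nat) (B : {set {ffun 'I_n -> T}})
    (f : {ffun 'I_n -> T}) : f \in B -> setdist B f = 0%N.
Proof.
move=> fB; apply/eqP; rewrite subn_eq0.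
apply: leq_trans (leq_bigmax_cond f fB).
rewrite -[X in (X <= _)%N]card_ord -cardsT.
by apply/subset_leq_card/fintype.subsetP => i _; rewrite inE.
Qed.

Lemma setdist_witness (T : finType) (n : nat) (B : {set {ffun 'I_n -> T}})
    (f : {ffun 'I_n -> T}) :
  (0 < #|B|)%N -> exists2 b, b \in B & setdist B f = #|[pred i | f i != b i]|.
Proof.
case/card_gt0P => b0 b0B.
have [|b bB E] := @eq_bigmax_cond _ (mem B) (fun b => #|[pred i | f i == b i]|).
  by apply/card_gt0P; exists b0.
exists b => //; rewrite /setdist E.
by rewrite -[X in (X - _)%N]card_ord -(cardC [pred i | f i == b i]) addKn.
Qed.

(** With F = exp(t * distance), F = 1 on [B] gives E[1/F] >= P(B), and Markov's inequality gives
    E[F] >= exp(tk) P(distance > k); the product of the two means is bounded above. *)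
Lemma blowup_prob_le (R : realType) (T : finType) (n : nat)
    (p : 'I_n -> T -> R) (B : {set {ffun 'I_n -> T}}) (t k : R) :
  (forall i, is_dist (p i)) -> 0 <= t ->
  (\sum_(f in B) \prod_i p i (f i)) *
  (\sum_(f : {ffun 'I_n -> T} | k < (setdist B f)%:R) \prod_i p i (f i))
    <= expR (- (t * k)) * ((expR t + expR (- t)) / 2) ^+ n.
Proof.
move=> pd t0; rewrite expRN ler_pdivlMl ?expR_gt0 // mulrCA.
have P0 (f : {ffun 'I_n -> T}) : 0 <= \prod_i p i (f i).
  by apply: prodr_ge0 => i _; have [q0 _] := pd i; exact: q0.
pose F (f : {ffun 'I_n -> T}) := expR (t * (setdist B f)%:R).
have F0 f : 0 < F f by exact: expR_gt0.
have FL i (f g : {ffun 'I_n -> T}) :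
    (forall j, j != i -> f j = g j) -> F f <= expR t * F g.
  move=> fg; rewrite /F -expRD ler_expR -{2}[t]mulr1 -mulrDr ler_wpM2l //.
  by rewrite nat1r ler_nat (setdist_lip _ fg).
rewrite expRN.
apply: le_trans (mean_mul_mean_inv_prod_le pd _ F0 FL); last by rewrite -expR0 ler_expR.
rewrite mulrC; apply: ler_pM.
- by rewrite mulr_ge0 ?expR_ge0 ?sumr_ge0.
- by rewrite sumr_ge0.
- rewrite mulr_sumr [X in X <= _]big_mkcond; apply: ler_sum => f _.
  case: ifP => [kf|_]; last by rewrite mulr_ge0 // ltW.
  by rewrite mulrC ler_wpM2l // ler_expR ler_wpM2l // ltW.
- rewrite [X in X <= _]big_mkcond; apply: ler_sum => f _.
  case: ifP => [fB|_]; last by rewrite divr_ge0 // ltW.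
  by rewrite /F setdist_mem // mulr0 expR0 divr1.
Qed.

(* Chernoff-type count: sum over y of exp(- l * d(y, b)) is a product over
   coordinates. *)
Lemma blowup_card_le (R : realType) (T : finType) (n : nat)
    (B : {set {ffun 'I_n -> T}}) (l k : R) :
  (0 < #|B|)%N -> 0 <= l ->
  #|[set f | (setdist B f)%:R <= k]|%:R <=
    expR (l * k) * #|B|%:R * (1 + expR (- l) * #|T|%:R) ^+ n.
Proof.
move=> B0 l0; rewrite -mulrA mulrC -ler_pdivrMr ?expR_gt0 // -expRN.
pose d (f b : {ffun 'I_n -> T}) := #|[pred i | f i != b i]|.
have dE f b : expR (- l) ^+ d f b = \prod_i (if f i == b i then 1 else expR (- l)).
  rewrite (bigID (fun i => f i == b i)) /= big1 ?mul1r => [|i ->] //.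
  rewrite (eq_bigr (fun=> expR (- l))) => [|i /negPf ->] //.
  by rewrite prodr_const.
have sumE b : \sum_(f : {ffun 'I_n -> T}) expR (- l) ^+ d f b <=
    (1 + expR (- l) * #|T|%:R) ^+ n.
  under eq_bigr do rewrite dE.
  rewrite (sum_prod_ffun (fun i a => if a == b i then 1 else expR (- l))).
  rewrite -[X in _ ^+ X]card_ord -prodr_const.
  apply: ler_prod => i _; rewrite sumr_ge0 => [|a _]; last first.
    by case: ifP => //; rewrite expR_ge0.
  rewrite (bigD1 (b i)) //= eqxx lerD2l.
  rewrite mulr_natr -sumr_const [X in X <= _]big_mkcond; apply: ler_sum => a _.
  by case: eqP; rewrite ?expR_ge0.
have cE (S : {set {ffun 'I_n -> T}}) (x : R) : #|S|%:R * x = \sum_(f in S) x.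
  by rewrite sumr_const mulr_natl.
rewrite !cE.
(* Each counted [f] has a nearest [b] in [B], whose term alone is at least exp(-lk). *)
apply: (@le_trans _ _ (\sum_(b in B) \sum_(f : {ffun 'I_n -> T}) expR (- l) ^+ d f b)).
  rewrite exchange_big /= [X in X <= _]big_mkcond /=; apply: ler_sum => f _.
  rewrite inE; case: ifP => [fk|_]; last by rewrite sumr_ge0 // => b _; rewrite exprn_ge0 ?expR_ge0.
  have [b bB E] := setdist_witness f B0.
  rewrite (bigD1 b) //= -[leLHS]addr0; apply: lerD.
    rewrite -expRM_natl ler_expR mulrN lerN2 mulrC ler_wpM2l //.
    by rewrite /d -E.
  by apply: sumr_ge0 => c _; rewrite exprn_ge0 ?expR_ge0.
by apply: ler_sum => b _.
Qed.

(** * Concentration of the conditional information *)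

Lemma ln2_gt0 (R : realType) : 0 < ln (2 : R).
Proof. by rewrite ln_gt0 // ltr1n. Qed.

Lemma ln2_le1 (R : realType) : ln (2 : R) <= 1.
Proof.
by rewrite -ler_expR lnK ?posrE //; apply: le_trans (expR_ge1Dx 1); lra.
Qed.

Lemma ln2_gt_half (R : realType) : 1 / 2 < ln (2 : R).
Proof.
rewrite -ltr_expR lnK ?posrE // -[1 / 2]opprK expRN.
rewrite -ltf_pV2 ?posrE ?invr_gt0 ?expR_gt0 // invrK.
apply: le_lt_trans (expR_gt1Dx _); first by lra.
by rewrite oppr_eq0 mulf_neq0 ?invr_neq0 ?pnatr_eq0 ?oner_neq0.
Qed.

Lemma pow2E (R : realType) (x : R) : 2 `^ x = expR (x * ln 2).
Proof. by rewrite /powR pnatr_eq0. Qed.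

Lemma lt_log2 (R : realType) (x y : R) : 0 < x -> (y < log2 x) = (2 `^ y < x).
Proof.
by move=> x0; rewrite /log2 ltr_pdivlMr ?ln2_gt0 // pow2E -[RHS]ltr_ln ?posrE ?expR_gt0 // expRK.
Qed.

Lemma log2_lt (R : realType) (x y : R) : 0 < x -> (log2 x < y) = (x < 2 `^ y).
Proof.
by move=> x0; rewrite /log2 ltr_pdivrMr ?ln2_gt0 // pow2E -[RHS]ltr_ln ?posrE ?expR_gt0 // expRK.
Qed.

Lemma pow2_log2 (R : realType) (x : R) : 0 < x -> 2 `^ log2 x = x.
Proof. by move=> x0; rewrite pow2E divfK ?gt_eqF ?ln2_gt0 // lnK. Qed.

Lemma pow2D (R : realType) (x y : R) : (2 : R) `^ (x + y) = 2 `^ x * 2 `^ y.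
Proof. by rewrite !pow2E mulrDl expRD. Qed.

(** Serves to extract p(u,x,y) <= p(x,y) from the marginal condition, which is a limit of partial
    sums over [u]. *)
Lemma term_le_sum_lim (R : realType) (a : nat -> R) (l : R) (u : nat) :
  (forall i, 0 <= a i) ->
  ((fun N : nat => \sum_(0 <= i < N) a i) @ \oo --> l)%classic -> a u <= l.
Proof.
move=> a0 al; pose s := fun N : nat => \sum_(0 <= i < N) a i.
have sl : (s @ \oo --> l)%classic by [].
have nd : nondecreasing_seq s.
  by apply/nondecreasing_seqP => N; rewrite /s big_nat_recr //= lerDl.
rewrite -(cvg_lim _ sl) //.
apply: le_trans (nondecreasing_cvgn_le nd _ u.+1).
  by rewrite /s big_nat_recr //= lerDr sumr_ge0.
by apply/cvg_ex; exists l.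
Qed.

Section Concentration.
Variables (R : realType) (X Y : finType) (n : nat).
Variables (pX : {ffun 'I_n -> X} -> R) (W : X -> Y -> R).
Hypothesis (pXd : is_dist pX) (Wc : is_channel W).

Definition out_pmf (y : {ffun 'I_n -> Y}) : R := \sum_x pX x * chan_n W x y.

Lemma chan_ge0 (x : {ffun 'I_n -> X}) (y : {ffun 'I_n -> Y}) : 0 <= chan_n W x y.
Proof. by apply: prodr_ge0 => i _; have [W0 _] := Wc (x i); exact: W0. Qed.

Lemma sum_chan (x : {ffun 'I_n -> X}) : \sum_(y : {ffun 'I_n -> Y}) chan_n W x y = 1.
Proof.
rewrite (sum_prod_ffun (fun i => W (x i))) big1 // => i _.
by have [] := Wc (x i).
Qed.

Lemma out_pmf_ge0 y : 0 <= out_pmf y.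
Proof. by apply: sumr_ge0 => x _; rewrite mulr_ge0 ?chan_ge0 //; case: pXd. Qed.

Lemma sum_out_pmf : \sum_y out_pmf y = 1.
Proof.
rewrite exchange_big; case: pXd => _ <- /=; apply: eq_bigr => x _.
by rewrite -mulr_sumr sum_chan mulr1.
Qed.

(** Each counted output has mass above 2^(-r), and the total mass is 1. *)
Lemma card_out_pmf_gt (r : R) : #|[set y | (2 : R) `^ (- r) < out_pmf y]|%:R <= (2 : R) `^ r.
Proof.
rewrite -[leRHS]mulr1 -[X in _ <= _ * X]sum_out_pmf -ler_pdivrMl ?powR_gt0 // -powRN.
rewrite mulr_natr -sumr_const [leLHS]big_mkcond.
apply: ler_sum => y _; rewrite inE; case: ifP => [/ltW //|_].
exact: out_pmf_ge0.
Qed.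

Section Markov.
Variables (pUXY : nat -> {ffun 'I_n -> X} -> {ffun 'I_n -> Y} -> R) (u : nat).
Hypothesis (M : markov_UXY pX W pUXY).

Let pUX x := \sum_y pUXY u x y.

Lemma joint_le x y : pUXY u x y <= pX x * chan_n W x y.
Proof.
by case: M => M0 [Ml _]; apply: (term_le_sum_lim u (fun i => M0 i x y) (Ml x y)).
Qed.

(** Divide the Markov identity by [pX x]; where [pX x] is 0, [joint_le] makes both sides vanish. *)
Lemma joint_marginal x y : pUXY u x y = pUX x * chan_n W x y.
Proof.
case: M => M0 [_ Mm]; have [x0|x0] := eqVneq (pX x) 0.
  have z y' : pUXY u x y' = 0.
    by apply/eqP; rewrite eq_le M0 andbT (le_trans (joint_le _ _)) // x0 mul0r.
  by rewrite z /pUX big1 ?mul0r // => y' _; rewrite z.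
by apply: (mulIf x0); rewrite Mm -/(pUX x) -mulrA [chan_n _ _ _ * _]mulrC.
Qed.

Lemma pUX_ge0 x : 0 <= pUX x.
Proof. by case: M => M0 _; apply: sumr_ge0. Qed.

Lemma pU_le1 : pU pUXY u <= 1.
Proof.
rewrite -sum_out_pmf exchange_big /=; apply: ler_sum => x _.
by apply: ler_sum => y _; exact: joint_le.
Qed.

Lemma joint_supp (A : {set {ffun 'I_n -> X}}) x :
  0 < pU pUXY u -> condP pUXY u (fun x _ => x \in A) = 1 -> x \notin A -> pUX x = 0.
Proof.
move=> u0 /(congr1 ( *%R^~ (pU pUXY u))).
rewrite /condP divfK ?gt_eqF // mul1r => E xA.
have : \sum_x \sum_(y | x \notin A) pUXY u x y = 0.
  apply: (addrI (\sum_x \sum_(y : {ffun 'I_n -> Y} | x \in A) pUXY u x y)).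
  rewrite addr0 -big_split /= [RHS]E /pU; apply: eq_bigr => z _.
  by case: (z \in A); rewrite ?big_pred0_eq ?addr0 ?add0r.
move=> /psumr_eq0P -/(_ _ x isT).
rewrite xA; apply => z _; apply: sumr_ge0 => y _; by case: M => M0 _.
Qed.

(** Up to null outputs, three events, each of conditional probability at most [e], cover the
    deviation: [y] in [D] (too likely), [y] outside [B], and [y] in [B] with p(y|u) <=
    2^(-(r+d)). *)
Lemma condP_concentration (A : {set {ffun 'I_n -> X}}) (D B : {set {ffun 'I_n -> Y}})
    (e r d : R) :
  0 < e ->
  (forall x, x \in A -> \sum_(y in D) chan_n W x y <= e) ->
  (forall x, x \in A -> \sum_(y in ~: B) chan_n W x y <= e) ->
  (forall y, (2 : R) `^ (d - r) < out_pmf y -> y \in D) ->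
  #|B|%:R * (2 : R) `^ (- (r + d)) < e ->
  0 < pU pUXY u -> condP pUXY u (fun x _ => x \in A) = 1 ->
  condP pUXY u (fun _ y => d + hU pUXY u < `|hY_U pUXY u y - r|) < 3 * e.
Proof.
move=> e0 HD HB HDr HBr u0 HA; case: (M) => M0 _.
rewrite /condP ltr_pdivrMr //.
pose m y := \sum_x pUXY u x y.
have m0 y : 0 <= m y by apply: sumr_ge0.
pose E y := d + hU pUXY u < `|hY_U pUXY u y - r|.
rewrite -[ltLHS]/(\sum_x \sum_(y | E y) pUXY u x y) exchange_big /=.
under eq_bigr do rewrite -/(m _).
have mS (S : {set {ffun 'I_n -> Y}}) :
    (* Given U = u, the output law is a mixture of the [chan_n W x] with [x] in [A], so bounds
       uniform over [A] transfer to it. *)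
    (forall x, x \in A -> \sum_(y in S) chan_n W x y <= e) ->
    \sum_(y in S) m y <= e * pU pUXY u.
  move=> HS; rewrite exchange_big mulr_sumr /=; apply: ler_sum => x _.
  rewrite -/(pUX x); under eq_bigr do rewrite joint_marginal.
  rewrite -mulr_sumr mulrC.
  have [xA|xA] := boolP (x \in A); first by rewrite ler_wpM2r ?pUX_ge0 // HS.
  by rewrite (joint_supp u0 HA) // !mulr0.
have hU0 : 0 <= hU pUXY u.
  by rewrite /hU oppr_ge0 /log2 ler_pdivrMr ?ln2_gt0 // mul0r ln_le0 // pU_le1.
have pUV : (2 : R) `^ hU pUXY u = (pU pUXY u)^-1 by rewrite /hU powRN pow2_log2.
(* Positivity is required since [log2 0] is 0 here; outputs with [m y = 0] add nothing to the
   sum. *)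
have key y : E y -> 0 < m y -> y \in D \/ m y <= (2 : R) `^ (- (r + d)) * pU pUXY u.
  move=> Ey my; have q0 : 0 < m y / pU pUXY u by rewrite divr_gt0.
  move: Ey; rewrite /E /hY_U -/(m y) lter_normr => /orP [h|h].
    right; rewrite -ler_pdivrMr //; apply: ltW.
    by rewrite -log2_lt //; lra.
  (* The slack h(U) exactly absorbs the factor p(u): p(y|u) > 2^(d-r) / p(u) gives p(u,y) >
     2^(d-r). *)
  left; apply: HDr; apply: (@lt_le_trans _ _ (m y)).
    rewrite -(@ltr_pM2r _ (pU pUXY u)^-1) ?invr_gt0 // -{1}pUV -pow2D.
    by rewrite -lt_log2 //; lra.
  by apply: ler_sum => x _; exact: joint_le.
have bound y : E y -> m y <= (if y \in D then m y else 0) + (if y \in ~: B then m y else 0)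
    + (if y \in B then (2 : R) `^ (- (r + d)) * pU pUXY u else 0).
  move=> Ey; have b0 : 0 <= (2 : R) `^ (- (r + d)) * pU pUXY u.
    by rewrite mulr_ge0 ?powR_ge0 // ltW.
  rewrite inE; have := m0 y; rewrite le_eqVlt => /orP [/eqP <-|my].
    by case: (y \in B); case: (y \in D); rewrite /= ?addr0 ?add0r.
  by case: (key y Ey my) => [->|h]; case: (y \in B) => /=; have := m0 y; case: (y \in D); lra.
have : \sum_(y | E y) m y <= \sum_(y in D) m y + \sum_(y in ~: B) m y
   + #|B|%:R * ((2 : R) `^ (- (r + d)) * pU pUXY u).
  rewrite mulr_natl -sumr_const [\sum_(y in D) _]big_mkcond.
  rewrite [\sum_(y in ~: B) _]big_mkcond [\sum_(y in B) _]big_mkcond -!big_split /=.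
  rewrite [leLHS]big_mkcond; apply: ler_sum => y _.
  case: ifP => [/bound //|_]; rewrite !addr_ge0 //; case: ifP => // _.
  by rewrite mulr_ge0 ?powR_ge0 // ltW.
move=> /le_lt_trans; apply.
have -> : 3 * e * pU pUXY u = e * pU pUXY u + e * pU pUXY u + e * pU pUXY u by ring.
apply: ler_ltD; first by rewrite lerD ?mS.
by rewrite mulrA ltr_pM2r.
Qed.

End Markov.
End Concentration.

(** * Slicing the input space *)

(* From expR x <= 1 / (1 - x): cosh t <= 1 / (1 - t^2). *)
Lemma cosh_le_expR_sqr (R : realType) (t : R) :
  t ^+ 2 <= 1 / 2 -> (expR t + expR (- t)) / 2 <= expR (2 * t ^+ 2).
Proof.
move=> t2.
have inv_bound (x : R) : 0 < 1 - x -> expR x <= (1 - x)^-1.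
  move=> x1; rewrite -[expR x]invrK lef_pV2 ?posrE ?invr_gt0 ?expR_gt0 //.
  by rewrite -expRN; exact: expR_ge1Dx.
have t1 : 0 < 1 - t by nra.
have t1' : 0 < 1 - - t by nra.
have d0 : 0 < 1 - t ^+ 2 by lra.
apply: (@le_trans _ _ (((1 - t)^-1 + (1 - - t)^-1) / 2)).
  by rewrite ler_pM2r ?invr_gt0 // lerD ?inv_bound.
have -> : ((1 - t)^-1 + (1 - - t)^-1) / 2 = (1 - t ^+ 2)^-1.
  by field; rewrite !gt_eqF //; move: t1'; rewrite opprK.
apply: le_trans (expR_ge1Dx _).
rewrite -[leLHS]mul1r ler_pdivrMr //.
by have := sqr_ge0 t; move: t2; set u := t ^+ 2 => *; nra.
Qed.

(** Taking t = sqrt a, the exponent is at most -4na + 2na = -2na; since ln 2 <= 1 this is below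
    2^(-2na), and one factor 2^(-na) cancels against P(B). *)
Lemma blowup_compl_le (R : realType) (T : finType) (n : nat)
    (p : 'I_n -> T -> R) (B : {set {ffun 'I_n -> T}}) (a : R) :
  (forall i, is_dist (p i)) -> 0 <= a -> a <= 1 / 2 ->
  (2 : R) `^ (- (n%:R * a)) <= \sum_(f in B) \prod_i p i (f i) ->
  \sum_(f : {ffun 'I_n -> T} | 4 * n%:R * Num.sqrt a < (setdist B f)%:R)
    \prod_i p i (f i) <= (2 : R) `^ (- (n%:R * a)).
Proof.
move=> pd a0 a1 hB; set S := \sum_(f | _) _.
have S0 : 0 <= S.
  by apply: sumr_ge0 => f _; apply: prodr_ge0 => i _; have [q0 _] := pd i; exact: q0.
have e0 : 0 < (2 : R) `^ (- (n%:R * a)) by rewrite powR_gt0.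
have sa : Num.sqrt a ^+ 2 = a by rewrite sqr_sqrtr.
rewrite -(ler_pM2l e0).
apply: le_trans (ler_wpM2r S0 hB) _.
apply: le_trans (blowup_prob_le _ _ pd (sqrtr_ge0 a)) _.
apply: (@le_trans _ _ (expR (- (4 * n%:R * a)) * expR (2 * a) ^+ n)).
  have -> : Num.sqrt a * (4 * n%:R * Num.sqrt a) = 4 * n%:R * a by rewrite -{3}sa; ring.
  rewrite ler_wpM2l ?expR_ge0 //; apply: lerXn2r; rewrite ?nnegrE ?expR_ge0 //.
  by rewrite -{3}sa cosh_le_expR_sqr // sa.
rewrite -expRM_natl -expRD -pow2D pow2E ler_expR.
have na : 0 <= n%:R * a by rewrite mulr_ge0.
by have := ln2_le1 R; have := ln2_gt0 R; nra.
Qed.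

Lemma pigeonhole_sum (R : realFieldType) (K : nat) (F : 'I_K -> R) (c : R) :
  (0 < K)%N -> c <= \sum_j F j -> exists j, c / K%:R <= F j.
Proof.
move=> K0 cF; apply: contrapT => /forallNP h.
move: cF; apply/negP; rewrite -ltNge.
have -> : c = \sum_(j < K) c / K%:R.
  by rewrite sumr_const card_ord -[RHS]mulr_natr divfK // pnatr_eq0 -lt0n.
apply: ltr_sum => [|j _].
  by apply/hasP; exists (Ordinal K0); rewrite ?mem_index_enum.
by rewrite ltNge; apply/negP; exact: h.
Qed.

Section Partition.
Variables (R : realType) (X Y : finType) (n : nat).
Variables (pX : {ffun 'I_n -> X} -> R) (W : X -> Y -> R).
Hypothesis (pXd : is_dist pX) (Wc : is_channel W).

(* {y : -log2 p_Y(y) < r}, phrased without log2 because log2 0 = 0 here. *)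
Definition likely (r : R) : {set {ffun 'I_n -> Y}} :=
  [set y | (2 : R) `^ (- r) < out_pmf pX W y].

Definition hit (r : R) (x : {ffun 'I_n -> X}) : R :=
  \sum_(y in likely r) chan_n W x y.

Definition slice (e w : R) (j : nat) : {set {ffun 'I_n -> X}} :=
  [set x | hit (w * j%:R) x < e <= hit (w * j.+1%:R) x].

(** No output has probability above 2^0 = 1, so [likely 0] is empty. *)
Lemma hit0 x : hit 0 x = 0.
Proof.
rewrite /hit big_pred0 // => y; rewrite inE oppr0 powRr0; apply/negbTE.
rewrite -leNgt -(sum_out_pmf pXd Wc) (bigD1 y) //= lerDl sumr_ge0 // => z _.
exact: out_pmf_ge0.
Qed.

Lemma mem_slice (e w : R) (K : nat) x : 0 < e -> e <= hit (w * K%:R) x ->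
  exists j : 'I_K, x \in slice e w j.
Proof.
move=> e0; elim: K => [|K IH]; first by rewrite mulr0 hit0 leNgt e0.
move=> eK; have [lt|ge] := ltP (hit (w * K%:R) x) e.
  by exists ord_max; rewrite inE lt.
by have [j xj] := IH ge; exists (widen_ord (leqnSn K) j).
Qed.

(** Outputs outside [likely L] have mass at most 1/4, so the mean of [hit L] is at least 3/4. As
    [hit L] is below 1/2 off the slices and at most 1 on them, 3/4 <= 1/2 + (slice mass)/2. *)
Lemma sum_slice (e w : R) (K : nat) :
  0 < e -> e <= 1 / 2 -> 1 - #|{ffun 'I_n -> Y}|%:R * (2 : R) `^ (- (w * K%:R)) >= 3 / 4 ->
  1 / 2 <= \sum_(j < K) \sum_(x in slice e w j) pX x.
Proof.
move=> e0 e1 hL; have [p0 p1] := pXd.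
set L := w * K%:R in hL *.
have hitL : 3 / 4 <= \sum_x pX x * hit L x.
  apply: le_trans hL _; rewrite lerBlDr.
  have -> : \sum_x pX x * hit L x = \sum_(y in likely L) out_pmf pX W y.
    by rewrite exchange_big; apply: eq_bigr => x _; rewrite mulr_sumr.
  rewrite -[leLHS](sum_out_pmf pXd Wc) (bigID (mem (likely L))) /= lerD2l.
  rewrite mulr_natl -sumr_const big_mkcond; apply: ler_sum => y _.
  by rewrite inE -leNgt; case: ifP; rewrite // powR_ge0.
have hit1 x : hit L x <= 1.
  rewrite -(sum_chan Wc x) [leLHS]big_mkcond; apply: ler_sum => y _.
  by case: ifP => // _; exact: chan_ge0.
have split_hit : \sum_x pX x * hit L x <=
    \sum_x pX x * (1 / 2 + 1 / 2 * \sum_(j < K) (x \in slice e w j)%:R).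
  apply: ler_sum => x _; apply: ler_wpM2l => //.
  have [lt|ge] := ltP (hit L x) e.
    apply: (@le_trans _ _ (1 / 2)); first by apply: ltW; apply: lt_le_trans e1.
    by rewrite lerDl mulr_ge0 // sumr_ge0.
  have [j xj] := mem_slice e0 ge.
  apply: le_trans (hit1 x) _; rewrite (bigD1 j) //= xj mulr1n.
  set S := \sum_(i < K | _) _; have : 0 <= S by rewrite sumr_ge0.
  lra.
have E : \sum_x pX x * (1 / 2 + 1 / 2 * \sum_(j < K) (x \in slice e w j)%:R) =
    1 / 2 + 1 / 2 * \sum_(j < K) \sum_(x in slice e w j) pX x.
  rewrite (eq_bigr (fun x => pX x * (1 / 2) +
    1 / 2 * (pX x * \sum_(j < K) (x \in slice e w j)%:R))) => [|x _]; last by ring.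
  rewrite big_split /= -mulr_suml p1 mul1r -mulr_sumr; congr (_ + _ * _).
  rewrite (eq_bigr (fun x => \sum_(j < K) pX x * (x \in slice e w j)%:R)) => [|x _];
    last by rewrite mulr_sumr.
  rewrite exchange_big; apply: eq_bigr => j _; rewrite [RHS]big_mkcond.
  by apply: eq_bigr => x _; case: (x \in _); rewrite ?mulr1 ?mulr0.
by have := le_trans hitL split_hit; rewrite E; lra.
Qed.
End Partition.

(** * Numerical estimates: number of bins and cardinalities *)

Lemma log2_gt0 (R : realType) (x : R) : 1 < x -> 0 < log2 x.
Proof. by move=> x1; rewrite divr_gt0 ?ln2_gt0 ?ln_gt0. Qed.

(** [K] is the floor of n/(2g), at least 1, so flooring loses at most a factor 2. The first bound
    makes 1/(2K) >= g/n; the second keeps the bins narrow. *)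
Lemma exists_bin_count (R : realType) (n : nat) : (27 <= n)%N ->
  let g := log2 (n%:R / 8 : R) in
  exists2 K, (0 < K)%N & K%:R * (2 * g) <= n%:R /\ n%:R <= K%:R * (4 * g).
Proof.
move=> n27 g.
have nR : 27 <= n%:R :> R by rewrite ler_nat.
have g0 : 0 < g by apply: log2_gt0; lra.
have gn : 2 * g <= n%:R.
  have : ln (n%:R / 8 : R) <= n%:R / 8 by apply: ltW; apply: ln_sublinear; lra.
  have -> : ln (n%:R / 8 : R) = g * ln 2 by rewrite divfK ?gt_eqF ?ln2_gt0.
  by have := ln2_gt_half R; nra.
clearbody g; have x1 : 1 <= n%:R / (2 * g) by rewrite ler_pdivlMr ?mul1r // mulr_gt0.
have /andP [Kx xK] := truncn_itv (le_trans ler01 x1).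
set K := Num.truncn _ in Kx xK.
have K0 : (0 < K)%N by rewrite -ltnS -(ltr_nat R); apply: le_lt_trans xK.
exists K => //; move: Kx xK; rewrite ler_pdivlMr ?ltr_pdivrMr ?mulr_gt0 // => Kx xK.
split=> //; apply: le_trans (ltW xK) _; rewrite -natr1.
have : 1 <= K%:R :> R by rewrite ler1n.
by nra.
Qed.

(** The left side equals m^(-n): it bounds the mass of all outputs of probability at most
    m^(-2n). *)
Lemma exp_mul_pow2_le (R : realType) (m n : nat) : (2 <= m)%N -> (2 <= n)%N ->
  (m ^ n)%:R * (2 : R) `^ (- (2 * n%:R * log2 (m%:R : R))) <= 1 / 4.
Proof.
move=> m2 n2; have m0 : 0 < m%:R :> R by rewrite ltr0n; lia.
have -> : (2 : R) `^ (- (2 * n%:R * log2 (m%:R : R))) = ((m ^ n)%:R ^+ 2)^-1.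
  rewrite powRN [2 * _ * _]mulrC powRrM pow2_log2 // -natrM powR_mulrn ?ler0n //.
  by rewrite natrX -exprM mulnC.
have mn : 4 <= (m ^ n)%:R :> R.
  rewrite ler_nat; apply: leq_trans (_ : 2 ^ n <= _)%N; last by rewrite leq_exp2r //; lia.
  by rewrite -[4%N]/(2 ^ 2)%N leq_exp2l.
rewrite expr2 invfM mulrA divff ?mul1r; last by lra.
by rewrite lef_pV2 ?posrE //; lra.
Qed.

(** Count with exp(-l) = sqrt a: exp(lk) gives the log2 a term, and (1 + sqrt a |T|)^n <= exp(n sqrt
    a |T|) gives the other, as 2 ln 2 > 1. *)
Lemma thickening_card_le (R : realType) (T : finType) (n : nat)
    (B : {set {ffun 'I_n -> T}}) (a q : R) :
  (0 < #|B|)%N -> 0 < a -> a <= 1 -> #|B|%:R <= (2 : R) `^ q ->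
  #|[set f | (setdist B f)%:R <= 4 * n%:R * Num.sqrt a]|%:R <=
    (2 : R) `^ (q + 2 * n%:R * Num.sqrt a * (- log2 a + #|T|%:R)).
Proof.
move=> B0 a0 a1 Bq.
have s0 : 0 < Num.sqrt a by rewrite sqrtr_gt0.
have lns : ln (Num.sqrt a) = ln a / 2 by rewrite -powR12_sqrt ?ltW // ln_powR mulrC.
have l0 : 0 <= - ln (Num.sqrt a) by rewrite lns; have := ln_le0 a1; lra.
apply: le_trans (blowup_card_le _ B0 l0) _.
rewrite opprK lnK // mulrAC.
have -> : (2 : R) `^ (q + 2 * n%:R * Num.sqrt a * (- log2 a + #|T|%:R)) =
    expR (- ln (Num.sqrt a) * (4 * n%:R * Num.sqrt a)) *
    expR (n%:R * (2 * Num.sqrt a * #|T|%:R * ln 2)) * (2 : R) `^ q.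
  rewrite !pow2E -!expRD lns /log2; congr expR.
  by field; rewrite gt_eqF ?ln2_gt0.
apply: ler_pM;
  rewrite ?mulr_ge0 ?expR_ge0 ?exprn_ge0 ?addr_ge0 ?ler01 ?mulr_ge0 ?ler0n ?sqrtr_ge0 //.
rewrite ler_wpM2l ?expR_ge0 // expRM_natl lerXn2r ?nnegrE ?expR_ge0 //.
apply: le_trans (expR_ge1Dx _) _; rewrite ler_expR.
have : 0 <= Num.sqrt a * #|T|%:R by rewrite mulr_ge0 ?ler0n ?sqrtr_ge0.
by have := ln2_gt_half R; nra.
Qed.

(** * Choice of the slice, the centre [r] and the deviation *)

Theorem theorem10 (R : realType) :
  exists c : nat -> nat -> R,
  forall (X Y : finType), (2 <= #|X|)%N -> (2 <= #|Y|)%N ->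
  0 < c #|X| #|Y| /\
  forall (n : nat) (pX : {ffun 'I_n -> X} -> R) (W : X -> Y -> R) (alpha : R),
    (27 <= n)%N -> is_dist pX -> is_channel W ->
    log2 (n%:R : R) / n%:R < alpha -> alpha < 1 / (8 * ln (2 : R)) ->
    exists (A : {set {ffun 'I_n -> X}}) (delta r : R),
      n%:R^-1 * log2 (n%:R / 8 : R) <= \sum_(x in A) pX x /\
      0 < delta /\ `|delta| <= c #|X| #|Y| * `|- Num.sqrt alpha * log2 alpha| /\
      0 < r /\ r < 2 * n%:R * log2 (#|Y|%:R : R) /\
      forall pUXY : nat -> {ffun 'I_n -> X} -> {ffun 'I_n -> Y} -> R,
        markov_UXY pX W pUXY ->
        forall u : nat, 0 < pU pUXY u ->
          condP pUXY u (fun x _ => x \in A) = 1 ->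
          condP pUXY u (fun _ y => n%:R * delta + hU pUXY u < `|hY_U pUXY u y - r|)
            < 3 * (2 : R) `^ (- (n%:R * alpha)).
Proof.
(* In units of sqrt(alpha) |log2 alpha|, [3 + 2 * m] pays for the thickening exponent and for alpha
   itself, and [8 * log2 m] for the bin width. *)
pose c (_ m : nat) : R := 3 + 2 * m%:R + 8 * log2 m%:R.
exists c => X Y X2 Y2.
set m := #|Y| in Y2 *; have mR : 2 <= m%:R :> R by rewrite ler_nat.
have lm0 : 0 < log2 (m%:R : R) by apply: log2_gt0; lra.
have c0 : 0 < c #|X| m by rewrite /c; lra.
split=> // n pX W a n27 pXd Wc na a_lt.
have nR : 27 <= n%:R :> R by rewrite ler_nat.
have n0 : 0 < n%:R :> R by lra.
have h2 := ln2_gt_half R.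
have lgn0 : 0 < log2 (n%:R : R) by apply: log2_gt0; lra.
have a0 : 0 < a by apply: lt_trans na; rewrite divr_gt0.
have a4 : a < 1 / 4.
  apply: lt_le_trans a_lt _; rewrite ler_pdivrMr; first by lra.
  by lra.
have ln_na : log2 (n%:R : R) < n%:R * a by rewrite mulrC -ltr_pdivrMr.
pose s := Num.sqrt a.
have s0 : 0 < s by rewrite sqrtr_gt0.
have ss : s * s = a by rewrite -expr2 sqr_sqrtr // ltW.
have s1 : s < 1 / 2 by nra.
pose L := - log2 a.
have L1 : 1 < L.
  rewrite /L ltrNr log2_lt // powRN powRr1 //; lra.
pose e := (2 : R) `^ (- (n%:R * a)).
have e0 : 0 < e by rewrite powR_gt0.
have e1 : e <= 1 / 2.
  rewrite /e powRN; have : n%:R < (2 : R) `^ (n%:R * a) by rewrite -log2_lt.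
  by move=> h; rewrite div1r lef_pV2 ?posrE ?powR_gt0 //; lra.
have [K K0 [Kg gK]] := exists_bin_count R n27.
set g := log2 (n%:R / 8 : R) in Kg gK *.
have KR : 0 < K%:R :> R by rewrite ltr0n.
pose w := 2 * n%:R * log2 (m%:R : R) / K%:R.
have wK : w * K%:R = 2 * n%:R * log2 (m%:R : R) by rewrite divfK ?gt_eqF.
have nm0 : 0 < 2 * n%:R * log2 (m%:R : R) by rewrite mulr_gt0 // mulr_gt0.
have w0 : 0 < w by rewrite divr_gt0.
have : 1 / 2 <= \sum_(j < K) \sum_(x in slice pX W e w j) pX x.
  apply: sum_slice => //; rewrite wK card_ffun card_ord -/m.
  by have := exp_mul_pow2_le R Y2 (leq_trans (isT : 2 <= 27)%N n27); lra.
move=> /(pigeonhole_sum K0) [j hj].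
set A := slice pX W e w j in hj.
have gn : g <= log2 (n%:R : R).
  rewrite /g /log2 ler_pM2r ?invr_gt0 ?ln2_gt0 // ler_ln ?posrE //; lra.
have g0 : 0 < g by apply: log2_gt0; lra.
pose d := c #|X| m * (s * L).
have sL0 : 0 < s * L by rewrite mulr_gt0 //; lra.
(* Here alpha > log2 n / n enters: g <= log2 n < n alpha forces 4 K alpha >= 1, and alpha <= s L. *)
have wle : w <= 8 * n%:R * log2 (m%:R : R) * (s * L).
  rewrite /w ler_pdivrMr //.
  have h1 : n%:R <= K%:R * (4 * (n%:R * a)).
    apply: le_trans gK _; rewrite ler_pM2l // ler_pM2l //.
    by apply/ltW/(le_lt_trans gn).
  have h3 : 1 <= K%:R * (4 * a).
    by rewrite -(ler_pM2l n0) mulr1; apply: le_trans h1 _; lra.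
  have h4 : a <= s * L by nra.
  have h5 : 1 <= K%:R * (4 * (s * L)) by apply: le_trans h3 _; rewrite ler_pM2l // ler_pM2l.
  have q0 : 0 <= 2 * n%:R * log2 (m%:R : R) by rewrite ltW.
  have -> : 8 * n%:R * log2 m%:R * (s * L) * K%:R =
    2 * n%:R * log2 m%:R * (K%:R * (4 * (s * L))) by ring.
  by rewrite -[leLHS]mulr1 ler_wpM2l.
have nd : w / 2 + 2 * n%:R * s * (L + m%:R) + n%:R * a < n%:R * d.
  have : n%:R * a <= n%:R * (s * L) by rewrite ler_pM2l //; nra.
  have : n%:R * (s * m%:R) <= n%:R * (s * L) * m%:R.
    by rewrite -mulrA ler_pM2l // -mulrA ler_pM2l // ler_peMl //; lra.
  have : 0 < n%:R * (s * L) by rewrite mulr_gt0.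
  have -> : n%:R * d = 3 * (n%:R * (s * L)) + 2 * (n%:R * (s * L) * m%:R) +
    8 * n%:R * log2 m%:R * (s * L) by rewrite /d /c; ring.
  have -> : 2 * n%:R * s * (L + m%:R) = 2 * (n%:R * (s * L)) + 2 * (n%:R * (s * m%:R)) by ring.
  by move: wle w0; lra.
have extra0 : 0 <= 2 * n%:R * s * (L + m%:R) + n%:R * a.
  by rewrite addr_ge0 ?mulr_ge0 ?addr_ge0 ?ler0n //; lra.
(* The midpoint of the bin: both thresholds are w/2 away, and 0 < r < wK. *)
pose r := w * j%:R + w / 2.
have jK : j%:R + 1 <= K%:R :> R by rewrite natr1 ler_nat ltn_ord.
have j0 : 0 <= j%:R :> R by [].
exists A, d, r; split.
  apply: le_trans hj; rewrite -/g ler_pdivlMr // -mulrA ler_pdivrMl //; lra.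
split; first by rewrite mulr_gt0.
split.
  have -> : - Num.sqrt a * log2 a = s * L by rewrite /L mulrN mulNr.
  by rewrite /d normrM (gtr0_norm c0).
split; first by rewrite /r; nra.
split; first by rewrite /r -wK; nra.
move=> pUXY M u u0 HA.
pose D1 := likely pX W (w * j.+1%:R).
pose B := [set f | (setdist D1 f)%:R <= 4 * n%:R * s].
have inA x : x \in A -> hit pX W (w * j%:R) x < e /\ e <= hit pX W (w * j.+1%:R) x.
  by rewrite inE => /andP.
(* The slice has positive mass, so it contains some [x], which gives [D1] mass at least e > 0. *)
have D10 : (0 < #|D1|)%N.
  have [x xA] : exists x, x \in A.
    apply: contrapT => /forallNP nx; move: hj; rewrite big_pred0 => [|x]; last by apply/negP/nx.
    by apply/negP; rewrite -ltNge divr_gt0.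
  have [_ he] := inA x xA; rewrite lt0n; apply/negP => /eqP /card0_eq D0.
  by move: he; rewrite /hit big_pred0 // leNgt e0.
apply: (condP_concentration pXd Wc M (D := likely pX W (w * j%:R)) (B := B)) u0 HA => //.
- by move=> x /inA [/ltW].
- move=> x /inA [_ he].
  rewrite (eq_bigl (fun f => 4 * n%:R * s < (setdist D1 f)%:R)) => [|f]; last first.
    by rewrite !inE ltNge.
  apply: (@blowup_compl_le R Y n (fun i => W (x i))) => //; [exact: ltW|lra].
- move=> y; rewrite inE; apply: le_lt_trans; apply: ler_powR; first by lra.
  by rewrite /r; lra.
(* log2 |D1| is at most r + w/2; [nd] absorbs w/2 and the thickening exponent and still leaves n
   alpha. *)
- apply: le_lt_trans (ler_wpM2r _ (thickening_card_le D10 a0 _ (card_out_pmf_gt pXd Wc _))) _.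
  + exact: powR_ge0.
  + by lra.
  rewrite -pow2D /e !pow2E ltr_expR ltr_pM2r ?ln2_gt0 //.
  by rewrite -/s -/L -/m /r -natr1; lra.
Qed.
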